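(* Let $G=(V,E)$ be a simple graph with uniformly bounded vertex degrees, let $\mathrm{Deg}_{\max}$ be its largest degree, and let $R\ge1$ be an integer. Suppose $K_R(x,y)\ge0$ for all $x,y\in V$ with $d(x,y)\le R$. Let $\lambda\in\mathbb{R}$ be an eigenvalue of $-\Delta$ with bounded eigenfunction $f:V\to\mathbb{R}$, i.e. $f\in\ell^\infty(V)$, $f\ne0$ and $-\Delta f=\lambda f$. Then, pointwise on $V$, $$|\nabla_Rf|^2\le 2eR\,\mathrm{Deg}_{\max}^{R-1}\,\lambda\,\|f\|_\infty^2 .$$
   Context: $d(x,y)$ is the combinatorial (path) distance. $\Delta f(x)=\sum_{y\sim x}(f(y)-f(x))$. $|\nabla_R f|(x)=\max_{d(x,y)\le R}|f(y)-f(x)|$. Gradient-Ollivier curvature: $$K_R(x,y)=\inf\big\{\Delta|\nabla_R f|(x)-(\Delta f(y)-\Delta f(x))\,\mathrm{sgn}(f(y)-f(x))\big\},$$ over all $f:V\to\mathbb{R}$ with $|\nabla_Rf|(x)=1$ and $|f(y)-f(x)|=|\nabla_R f|(x)$ (with $\inf\emptyset=+\infty$). Here $e$ is Euler's number. *)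

(* Defs.v *)
From mathcomp Require Import all_boot all_order all_algebra.
From mathcomp Require Import all_classical all_reals all_analysis.
Import Order.TTheory GRing.Theory Num.Theory.
Import numFieldNormedType.Exports.

Set Implicit Arguments.
Unset Strict Implicit.
Unset Printing Implicit Defensive.

Local Open Scope classical_set_scope.
Local Open Scope ring_scope.

(* A simple graph is a symmetric and irreflexive relation [e : rel V] on a     *)
(* possibly infinite vertex set; it need not be connected.                     *)

Definition neighbors (V : Type) (e : rel V) (x : V) : set V := [set y | e x y].

(* Uses cardinal comparison with {0, ..., D-1}, so [max_degree e D] entails    *)
(* that every vertex has a finite number of neighbors, uniformly bounded.      *)
Definition max_degree (V : Type) (e : rel V) (D : nat) : Prop :=
  (forall x, (neighbors e x #<= `I_D)%card) /\ (exists x, (neighbors e x #= `I_D)%card).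

(* +oo between vertices of different connected components *)
Definition graph_dist (R : realType) (V : Type) (e : rel V) (x y : V) : \bar R :=
  ereal_inf [set (size p)%:R%:E | p in [set p | path e x p /\ last x p = y]].

Definition laplacian (R : realType) (V : choiceType) (e : rel V) (f : V -> R)
    (x : V) : R :=
  \sum_(y \in neighbors e x) (f y - f x).

(* When vertex degrees are finite, the ball of radius r is finite (and it      *)
(* contains x), so that this supremum is a maximum.                            *)
Definition grad (R : realType) (V : Type) (e : rel V) (r : nat) (f : V -> R)
    (x : V) : R :=
  sup [set `|f y - f x| | y in [set y | (graph_dist R e x y <= r%:R%:E)%E]].

(* ereal_inf set0 = +oo *)
Definition gradient_ollivier (R : realType) (V : choiceType) (e : rel V)
    (r : nat) (x y : V) : \bar R :=
  ereal_inf
    [set (laplacian e (grad e r f) x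
          - (laplacian e f y - laplacian e f x) * Num.sg (f y - f x))%:E
    | f in [set f : V -> R |
             grad e r f x = 1 /\ `|f y - f x| = grad e r f x]].

Definition sup_norm (R : realType) (V : Type) (f : V -> R) : R :=
  sup (range (fun x => `|f x|)).

(* Main.v *)
(* Write mu = 1 - lambda/D for D = Degmax, and let W = I + Delta/D be the
   lazy random walk, so that W f = mu f. Nonnegative curvature makes
   g = |grad_r f| satisfy Delta g >= - lambda g, i.e. W g >= mu g. A walk of
   length at most r leads from x to a point attaining g(x); it is followed with
   probability at least D^-r, so the second moment of f around f(x) under
   A = W^r gives
     A f^2 >= (1 - a) f^2 + D^-r g^2,   A g^2 >= (1 - a) g^2,   a = 2 r lambda/D.
   Iterating n times, n D^-r (1 - a)^(n-1) g^2 <= A^n f^2 <= ||f||^2, and the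
   choice n = floor(1/a) gives the bound. When lambda is not small compared to
   1/(r D^(r-1)), the bound already follows from g <= 2 ||f||. *)
Require Import Defs.
From mathcomp Require Import all_boot all_order all_algebra.
From mathcomp Require Import all_classical all_reals all_analysis.
From mathcomp Require Import finmap lra ring.
Import Order.TTheory GRing.Theory Num.Theory.
Import numFieldNormedType.Exports.

Local Open Scope classical_set_scope.
Local Open Scope ring_scope.

(** * Elementary inequalities and the optimization over the number of steps *)

(** Bernoulli's inequality; it later compares [mu ^+ r] with a quantity linear in [lambda]. *)
Lemma ge1_add_natmul_exprn {R : realDomainType} (x : R) (n : nat) :
  0 <= x <= 1 -> 1 - n%:R * x <= (1 - x) ^+ n.
Proof.
move=> /andP[x0 x1]; elim: n => [|n IH]; first by rewrite mul0r subr0 expr0.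
rewrite exprSr; apply: le_trans (ler_wpM2r _ IH); last lra.
rewrite -natr1; have : 0 <= n%:R * (x * x) by rewrite !mulr_ge0.
by lra.
Qed.

(* The integer [n = floor (1/a)] nearly maximizes [n a (1-a)^(n-1)], and both
   ends of the range [1/(n+1) <= a <= 1/n] give at least [1/e]. *)
Lemma exists_natmul_exprn_ge {R : realType} (a : R) :
  0 < a -> a <= 1 ->
  exists n : nat, 1 <= expR 1 * (a * (n.+1%:R * (1 - a) ^+ n)).
Proof.
move=> a0 a1.
have [a_eq1|a_neq1] := eqVneq a 1.
  exists 0%N; rewrite a_eq1 expr0 !mulr1.
  by apply: le_trans (expR_ge1Dx _); lra.
have {a_neq1} a1' : a < 1 by rewrite lt_neqAle a_neq1.
have b0 : 0 < 1 - a by lra.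
pose N := Num.truncn a^-1.
have /andP[Nle Nlt] : N%:R <= a^-1 < N.+1%:R.
  by rewrite truncn_itv // invr_ge0 ltW.
have N0 : (0 < N)%N.
  rewrite lt0n; apply/eqP => N0; move: Nlt; rewrite N0 ltNge => /negP; apply.
  by rewrite invf_ge1.
exists N.-1; rewrite (prednK N0).
set s := a * N%:R.
have s1 : s <= 1 by rewrite /s mulrC -ler_pdivlMr// mul1r.
have sa : 1 - a < s.
  move: Nlt; rewrite -natr1 -(ltr_pM2l a0) mulfV ?gt_eqF// mulrDr mulr1 -/s.
  by lra.
(* Inverse of [1 + t <= expR t] at [t = a / (1 - a)], where [1 + t = (1 - a)^-1]. *)
have expV : expR (- (a / (1 - a))) <= 1 - a.
  rewrite expRN -[leRHS]invrK lef_pV2 ?posrE ?expR_gt0 ?invr_gt0//.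
  apply: le_trans (expR_ge1Dx _).
  by rewrite le_eqVlt; apply/orP; left; apply/eqP; field; lra.
have powE : expR (- ((s - a) / (1 - a))) <= (1 - a) ^+ N.-1.
  have -> : - ((s - a) / (1 - a)) = N.-1%:R * - (a / (1 - a)).
    rewrite /s -[in LHS](prednK N0) -natr1; field; lra.
  by rewrite expRM_natl lerXn2r // nnegrE ?expR_ge0// ltW.
have -> : expR 1 * (a * (N%:R * (1 - a) ^+ N.-1))
    = s * (expR 1 * (1 - a) ^+ N.-1) by rewrite /s; ring.
have sgt0 : 0 < s by lra.
(* By [powE], the product of [expR 1] and the power is at least [expR ((1 - s) / (1 - a))], which is
   bounded below by its tangent at 0. The resulting value is at least [s + (1 - s)], because
   [1 - a < s <= 1]. *)
apply: (@le_trans _ _ (s * (1 + (1 - s) / (1 - a)))).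
  have : (1 - s) <= s * ((1 - s) / (1 - a)).
    rewrite mulrCA -[leLHS]mulr1 ler_wpM2l//; first lra.
    by rewrite ler_pdivlMr// mul1r ltW.
  by rewrite mulrDr; lra.
rewrite ler_wpM2l// ?(ltW sgt0)//.
apply: le_trans (ler_wpM2l (expR_ge0 1) powE); rewrite -expRD.
apply: le_trans (expR_ge1Dx _); rewrite le_eqVlt; apply/orP; left; apply/eqP.
by field; lra.
Qed.

(** Extracts the best bound from a family indexed by the number of iterations. For [a = 0] the
    family grows linearly in [n], so the Archimedean property rules out [X > 0]. *)
Lemma le_expR_of_natmul_exprn {R : realType} (a X Y : R) :
  0 <= a -> a <= 1 -> 0 <= Y ->
  (forall n : nat, n.+1%:R * (1 - a) ^+ n * X <= Y) ->
  X <= expR 1 * a * Y.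
Proof.
move=> a0 a1 Y0 H.
have [X0|X0] := leP X 0.
  by apply: (le_trans X0); rewrite !mulr_ge0// expR_ge0.
have [a_eq0|a_neq0] := eqVneq a 0.
  have := H (Num.truncn (Y / X)); rewrite a_eq0 subr0 expr1n mulr1.
  by rewrite leNgt -ltr_pdivrMr// truncnS_gt.
have [|n Hn] := exists_natmul_exprn_ge a _ a1; first by rewrite lt0r a_neq0.
apply: (@le_trans _ _ (expR 1 * a * (n.+1%:R * (1 - a) ^+ n * X))).
  rewrite -[leLHS]mul1r.
  have -> : expR 1 * a * (n.+1%:R * (1 - a) ^+ n * X)
    = expR 1 * (a * (n.+1%:R * (1 - a) ^+ n)) * X by ring.
  by rewrite ler_wpM2r// ltW.
by rewrite ler_wpM2l// mulr_ge0// expR_ge0.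
Qed.

(** * Moment inequalities for Markov operators *)

(** A transition kernel seen only through its action on functions; this form is stable under
    iteration and suffices for variance arguments. *)
Definition is_markov {R : realType} {V : Type} (A : (V -> R) -> V -> R) : Prop :=
  [/\ forall (a b : R) (u v : V -> R) (x : V),
        A (fun z => a * u z + b * v z) x = a * A u x + b * A v x,
      forall u v : V -> R, (forall z, u z <= v z) -> forall x, A u x <= A v x
    & forall (c : R) (x : V), A (fun=> c) x = c].

Section Markov.
Context {R : realType} {V : Type} {A : (V -> R) -> V -> R}.
Hypothesis mA : is_markov A.

Lemma is_markov_iter (n : nat) : is_markov (iter n A).
Proof.
case: mA => linA leA constA; elim: n => [|n [linn len constn]]; first by split.
split=> [a b u v x|u v uv x|c x] /=.
- rewrite -linA; congr (A _ x); apply/funext => z; exact: linn.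
- by apply: leA; exact: len.
- by rewrite -[RHS](constA c x); congr (A _ x); apply/funext => z; exact: constn.
Qed.

Lemma markovZ (a : R) (u : V -> R) (x : V) : A (fun z => a * u z) x = a * A u x.
Proof.
case: mA => linA _ _; rewrite -[RHS]addr0 -(mul0r (A u x)) -linA.
by congr (A _ x); apply/funext => z; rewrite mul0r addr0.
Qed.

Lemma markov_ge0 (u : V -> R) (x : V) : (forall z, 0 <= u z) -> 0 <= A u x.
Proof. by case: mA => _ leA constA u0; rewrite -(constA 0 x); exact: leA. Qed.

Lemma markov_sqrB (u : V -> R) (c : R) (x : V) :
  A (fun z => (u z - c) ^+ 2) x
  = A (fun z => u z ^+ 2) x - 2 * c * A u x + c ^+ 2.
Proof.
case: mA => linA _ constA.
have -> : (fun z => (u z - c) ^+ 2)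
    = (fun z => 1 * u z ^+ 2 + 1 * (- (2 * c) * u z + 1 * c ^+ 2)).
  by apply/funext => z; ring.
by rewrite linA (linA (- (2 * c)) 1) constA; ring.
Qed.

(** The variance of [u] around its mean [A u x] is nonnegative. *)
Lemma markov_jensen (u : V -> R) (x : V) :
  A u x ^+ 2 <= A (fun z => u z ^+ 2) x.
Proof.
have := @markov_ge0 (fun z => (u z - A u x) ^+ 2) x (fun=> sqr_ge0 _).
by rewrite markov_sqrB; lra.
Qed.

Lemma markov_jensen_le (m : R) (u : V -> R) (x : V) :
  0 <= m -> 0 <= u x -> m * u x <= A u x ->
  m ^+ 2 * u x ^+ 2 <= A (fun z => u z ^+ 2) x.
Proof.
move=> m0 u0 mu; apply: le_trans (markov_jensen u x).
by rewrite -exprMn lerXn2r// nnegrE ?mulr_ge0//; apply: le_trans mu; rewrite mulr_ge0.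
Qed.

Lemma markov_iter_ge (m : R) (u : V -> R) (n : nat) (x : V) :
  0 <= m -> (forall z, m * u z <= A u z) -> m ^+ n * u x <= iter n A u x.
Proof.
case: (mA) => _ leA _ m0 mu; elim: n x => [|n IH] x; first by rewrite expr0 mul1r.
rewrite exprSr -mulrA iterS; apply: (@le_trans _ _ (m ^+ n * A u x)).
  by rewrite ler_wpM2l// exprn_ge0.
by rewrite -markovZ; exact: leA.
Qed.

Lemma markov_iter_eigen (m : R) (u : V -> R) (n : nat) (x : V) :
  (forall z, A u z = m * u z) -> iter n A u x = m ^+ n * u x.
Proof.
move=> mu; elim: n x => [|n IH] x; first by rewrite expr0 mul1r.
rewrite iterS; have -> : iter n A u = (fun z => m ^+ n * u z) by apply/funext.
by rewrite markovZ mu exprSr mulrA.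
Qed.

(** Every application of [A] to [u] releases a source [d * v]. Since [v] shrinks at most by the same
    factor [nu] as [u], all [n.+1] contributions carry the same weight [nu ^+ n], hence the linear
    growth. *)
Lemma markov_iter_source_ge (d nu : R) (u v : V -> R) (n : nat) (x : V) :
  0 <= d -> 0 <= nu ->
  (forall z, nu * u z + d * v z <= A u z) -> (forall z, nu * v z <= A v z) ->
  nu ^+ n.+1 * u x + n.+1%:R * d * nu ^+ n * v x <= iter n.+1 A u x.
Proof.
case: (mA) => linA leA _ d0 nu0 uP vP; elim: n x => [|n IH] x.
  by rewrite expr1 expr0 mulr1 mul1r.
have := leA _ _ IH x; rewrite linA -iterS; apply: le_trans.
apply: (@le_trans _ _ (nu ^+ n.+1 * (nu * u x + d * v x)
                       + n.+1%:R * d * nu ^+ n * (nu * v x))).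
  rewrite le_eqVlt; apply/orP; left; apply/eqP.
  by rewrite -[n.+2%:R]natr1 !exprS; ring.
by rewrite lerD// ler_wpM2l// ?mulr_ge0// exprn_ge0.
Qed.

End Markov.

(* The variance of [u] under [iter k A] around [u x] provides the gradient
   term; the remaining [n - k] steps cost a factor [m ^+ (2 * (n - k))]. *)
Lemma markov_iter_eigen_sqr_ge {R : realType} {V : Type}
    {A : (V -> R) -> V -> R} (m q w : R) (u : V -> R) (k n : nat) (x : V) :
  is_markov A -> 0 <= m <= 1 -> 0 <= w -> 0 <= q -> (k <= n)%N ->
  (forall z, A u z = m * u z) ->
  q ^+ k * w <= iter k A (fun z => (u z - u x) ^+ 2) x ->
  k = n \/ q <= m ^+ 2 ->
  (2 * m ^+ n - 1) * u x ^+ 2 + q ^+ n * w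
    <= iter n A (fun z => u z ^+ 2) x.
Proof.
move=> mA /andP[m0 m1] w0 q0 kn mu wk kq.
have mk := is_markov_iter mA k.
have step1 : (2 * m ^+ k - 1) * u x ^+ 2 + q ^+ k * w
    <= iter k A (fun z => u z ^+ 2) x.
  move: wk; rewrite (markov_sqrB mk) (markov_iter_eigen mA m u k x mu).
  by lra.
set j := (n - k)%N.
(* By Jensen, one application of [A] to [u ^+ 2] loses at most a factor [m ^+ 2]. *)
have step2 : (m ^+ j) ^+ 2 * iter k A (fun z => u z ^+ 2) x
    <= iter n A (fun z => u z ^+ 2) x.
  have -> : n = (k + j)%N by rewrite subnKC.
  rewrite iterD -(markovZ mk); have [_ lek _] := mk; apply: lek => z.
  rewrite -exprM mulnC exprM; apply: (markov_iter_ge mA) => [|y].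
    exact: sqr_ge0.
  by rewrite -exprMn -mu markov_jensen.
apply: le_trans step2; apply: le_trans (ler_wpM2l (sqr_ge0 _) step1).
have pk : m ^+ n = m ^+ j * m ^+ k by rewrite -exprD subnK.
have qk : q ^+ n = q ^+ j * q ^+ k by rewrite -exprD subnK.
rewrite [leRHS]mulrDr; apply: lerD.
  rewrite [leRHS]mulrA ler_wpM2r ?sqr_ge0// pk.
  have : 0 <= m ^+ j <= 1 by rewrite exprn_ge0 ?exprn_ile1.
  have : 0 <= m ^+ k <= 1 by rewrite exprn_ge0 ?exprn_ile1.
  set p := m ^+ j; set s := m ^+ k => /andP[s0 s1] /andP[p0 p1].
  (* This product equals [p ^+ 2 * (2 * s - 1) - (2 * (p * s) - 1)], the difference of the two
     sides. *)
  have : 0 <= (1 - p) * ((1 - p) + 2 * p * (1 - s)).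
    have : 0 <= p * (1 - s) by rewrite mulr_ge0// subr_ge0.
    by move=> ?; rewrite mulr_ge0//; lra.
  by lra.
rewrite [leRHS]mulrA ler_wpM2r// qk ler_wpM2r ?exprn_ge0//.
case: kq => [kn'|qm]; first by rewrite /j kn' subnn !expr0 expr1n.
by rewrite -exprM mulnC exprM lerXn2r// nnegrE sqr_ge0.
Qed.

(** * The Laplacian and the lazy random walk *)

Section Neighbors.
Context {R : realType} {V : choiceType} {e : rel V} {D : nat}.
Hypothesis degD : forall x, (neighbors e x #<= `I_D)%card.

Let nbr x := fset_set (neighbors e x).

Lemma finite_neighbors x : finite_set (neighbors e x).
Proof. exact: card_le_finite (degD x) (finite_II D). Qed.

Lemma mem_nbr x y : (y \in finmap.enum_fset (nbr x)) = e x y.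
Proof. by rewrite -[LHS]/(y \in nbr x) in_fset_set ?mem_setE//; exact: finite_neighbors. Qed.

Lemma size_nbr x : (size (nbr x) <= D)%N.
Proof. exact: geq_card_fset_set. Qed.

Lemma laplacianE (u : V -> R) x :
  laplacian e u x = \sum_(y <- nbr x) u y - (size (nbr x))%:R * u x.
Proof.
rewrite /laplacian fsbig_finite; last exact: finite_neighbors.
by rewrite sumrB big_const_seq count_predT iter_addr_0 mulr_natl.
Qed.

Lemma laplacianZ (c : R) (u : V -> R) x :
  laplacian e (fun z => c * u z) x = c * laplacian e u x.
Proof. by rewrite !laplacianE -mulr_sumr; ring. Qed.

Lemma laplacian_ge0 (u : V -> R) x :
  (forall z, 0 <= u z) -> u x = 0 -> 0 <= laplacian e u x.
Proof. by move=> u0 ux; rewrite laplacianE ux mulr0 subr0 sumr_ge0. Qed.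

Definition lazy_walk (u : V -> R) (x : V) : R := u x + laplacian e u x / D%:R.

Hypothesis D_gt0 : (0 < D)%N.

(** The degree bound makes all coefficients of this averaging form nonnegative, whence the
    monotonicity of the walk. *)
Lemma lazy_walkE (u : V -> R) x :
  lazy_walk u x =
  D%:R^-1 * (\sum_(y <- nbr x) u y + (D - size (nbr x))%:R * u x).
Proof.
rewrite /lazy_walk laplacianE natrB ?size_nbr//.
by field; rewrite pnatr_eq0 -lt0n.
Qed.

Lemma is_markov_lazy_walk : is_markov lazy_walk.
Proof.
split=> [a b u v x|u v uv x|c x].
- rewrite !lazy_walkE big_split /= -!mulr_sumr; ring.
- rewrite !lazy_walkE ler_wpM2l// ?invr_ge0// lerD ?ler_sum// ler_wpM2l//.
- rewrite lazy_walkE big_const_seq count_predT iter_addr_0 -mulr_natl natrB ?size_nbr//.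
  by field; rewrite pnatr_eq0 -lt0n.
Qed.

Lemma lazy_walk_ge (u : V -> R) x y :
  (forall z, 0 <= u z) -> e x y -> D%:R^-1 * u y <= lazy_walk u x.
Proof.
move=> u0 exy; rewrite lazy_walkE ler_wpM2l ?invr_ge0//.
rewrite (big_rem y) /= ?mem_nbr// -addrA lerDl addr_ge0 ?mulr_ge0 ?sumr_ge0//.
Qed.

(** As [u] is nonnegative, all trajectories except the one following [p] can be discarded. *)
Lemma iter_lazy_walk_ge (u : V -> R) x p :
  (forall z, 0 <= u z) -> path e x p ->
  D%:R^-1 ^+ size p * u (last x p) <= iter (size p) lazy_walk u x.
Proof.
move=> u0; elim: p x => [|y p IH] x /=; first by rewrite expr0 mul1r.
move=> /andP[exy yp]; rewrite exprS -mulrA.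
apply: (@le_trans _ _ (D%:R^-1 * iter (size p) lazy_walk u y)).
  by rewrite ler_wpM2l ?invr_ge0//; exact: IH.
apply: lazy_walk_ge => // z.
exact: markov_ge0 (is_markov_iter is_markov_lazy_walk _) _ _ u0.
Qed.

End Neighbors.
Arguments lazy_walk {R V} e D u x.

(** * Distance balls, the gradient and curvature *)

Lemma graph_dist_leP {R : realType} {V : Type} {e : rel V} {x y : V} {n : nat} :
  (graph_dist R e x y <= n%:R%:E)%E <->
  exists p, [/\ path e x p, last x p = y & (size p <= n)%N].
Proof.
split=> [xy|[p [xp py pn]]]; last first.
  apply: (@le_trans _ _ (size p)%:R%:E); last by rewrite lee_fin ler_nat.
  by apply: ge_ereal_inf; exists (size p)%:R%:E => //; exists p.
(* A strict bound is needed to extract a path from the infimum; lengths below [n.+1] are at most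
   [n]. *)
have : (graph_dist R e x y < n.+1%:R%:E)%E.
  by apply: le_lt_trans xy _; rewrite lte_fin ltr_nat.
move=> /ereal_inf_lt[_ [p [xp py] <-]]; rewrite lte_fin ltr_nat => pn.
by exists p.
Qed.

Lemma finite_set_sup {R : realType} (A : set R) :
  A !=set0 -> finite_set A -> A (sup A) /\ ubound A (sup A).
Proof.
move=> A0 /finite_compact cA.
have [|c cinA cmax] := @compact_EVT_max R R id A A0 cA.
  by apply: continuous_subspaceT => z; exact: cvg_id.
have cub : ubound A c by move=> t At; exact: cmax (mem_set At).
have Ac : A c := set_mem cinA.
suff -> : sup A = c by [].
apply/eqP; rewrite eq_le; apply/andP; split; first exact: ge_sup.
by apply: ub_le_sup => //; exists c.
Qed.

Section Gradient.
Context {R : realType} {V : choiceType} {e : rel V} {D : nat}.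
Hypothesis degD : forall x, (neighbors e x #<= `I_D)%card.

Lemma finite_graph_ball n x :
  finite_set [set y | (graph_dist R e x y <= n%:R%:E)%E].
Proof.
elim: n x => [|n IH] x.
  apply: sub_finite_set (finite_set1 x) => y /graph_dist_leP[p [_ <-]].
  by rewrite leqn0 => /nilP ->.
apply: (@sub_finite_set _ _ ([set x] `|` \bigcup_(z in neighbors e x)
    [set y | (graph_dist R e z y <= n%:R%:E)%E])).
  move=> y /graph_dist_leP[[|z p] [/= xp py pn]]; first by left.
  move: xp => /andP[xz zp]; right; exists z => //=.
  by apply/graph_dist_leP; exists p.
rewrite finite_setU; split; first exact: finite_set1.
by apply: bigcup_finite => //; exact: finite_neighbors degD _.
Qed.

Lemma grad_max n (u : V -> R) x :
  (exists y, (graph_dist R e x y <= n%:R%:E)%E /\ `|u y - u x| = grad e n u x)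
  /\ forall y, (graph_dist R e x y <= n%:R%:E)%E ->
       `|u y - u x| <= grad e n u x.
Proof.
have [||[y xy yE] gP] := @finite_set_sup R
    [set `|u y - u x| | y in [set y | (graph_dist R e x y <= n%:R%:E)%E]].
- by exists `|u x - u x|; exists x => //; apply/graph_dist_leP; exists [::].
- by apply: finite_image; exact: finite_graph_ball.
split=> [|z xz]; first by exists y.
by apply: gP; exists z.
Qed.

Lemma grad_attained n (u : V -> R) x :
  exists y, (graph_dist R e x y <= n%:R%:E)%E /\ `|u y - u x| = grad e n u x.
Proof. by have [] := grad_max n u x. Qed.

Lemma le_grad n (u : V -> R) x y :
  (graph_dist R e x y <= n%:R%:E)%E -> `|u y - u x| <= grad e n u x.
Proof. by have [_ +] := grad_max n u x; apply. Qed.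

Lemma grad_ge0 n (u : V -> R) x : 0 <= grad e n u x.
Proof. by have [y [_ <-]] := grad_attained n u x. Qed.

Lemma gradZ n (c : R) (u : V -> R) x :
  0 <= c -> grad e n (fun z => c * u z) x = c * grad e n u x.
Proof.
move=> c0; apply/eqP; rewrite eq_le; apply/andP; split.
  have [y [xy <-]] := grad_attained n (fun z => c * u z) x.
  by rewrite -mulrBr normrM (ger0_norm c0) ler_wpM2l// le_grad.
have [y [xy <-]] := grad_attained n u x.
by rewrite -{1}(ger0_norm c0) -normrM mulrBr (le_grad n (fun z => c * u z)).
Qed.

(* Nonnegative curvature, applied to [u] normalized by its gradient at [x] and
   to a point [y] attaining that gradient. *)
Lemma laplacian_grad_ge n (lambda : R) (u : V -> R) x :
  (forall y : V, (graph_dist R e x y <= n%:R%:E)%E ->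
     (0 <= gradient_ollivier R e n x y)%E) ->
  (forall z, - laplacian e u z = lambda * u z) ->
  - lambda * grad e n u x <= laplacian e (grad e n u) x.
Proof.
(* A vanishing gradient cannot be normalized, but then [x] minimizes the gradient and its Laplacian
   there is nonnegative. *)
move=> K0 eigen; have := grad_ge0 n u x; rewrite le_eqVlt => /predU1P[g0|g_gt0].
  rewrite -g0 mulr0; apply: (laplacian_ge0 degD) => // z; exact: grad_ge0.
have [y [xy gE]] := grad_attained n u x.
set c := (grad e n u x)^-1.
have c_gt0 : 0 < c by rewrite invr_gt0.
pose v z := c * u z.
have gv : grad e n v = (fun z => c * grad e n u z).
  by apply/funext => z; rewrite gradZ// ltW.
have vB : v y - v x = c * (u y - u x) by rewrite /v mulrBr.
have : ((0%R : R)%:E <= (laplacian e (grad e n v) x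
    - (laplacian e v y - laplacian e v x) * Num.sg (v y - v x))%:E)%E.
  apply: le_trans (K0 _ xy) _; apply: ge_ereal_inf; eexists; last exact: lexx.
  exists v => //; split; first by rewrite gv mulVf// gt_eqF.
  by rewrite gv vB normrM gtr0_norm// gE.
rewrite lee_fin gv !(laplacianZ degD) vB sgrM gtr0_sg// mul1r.
have -> : laplacian e u y = - (lambda * u y) by rewrite -eigen opprK.
have -> : laplacian e u x = - (lambda * u x) by rewrite -eigen opprK.
have -> : (c * - (lambda * u y) - c * - (lambda * u x)) * Num.sg (u y - u x)
    = - (c * lambda * ((u y - u x) * Num.sg (u y - u x))) by ring.
rewrite [_ * Num.sg _]mulrC -normrEsg gE opprK -mulrA -mulrDr pmulr_rge0//.
by lra.
Qed.

End Gradient.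

(** * Bounded eigenfunctions and constraints on the eigenvalue *)

Lemma sup_norm_ge {R : realType} {V : Type} (f : V -> R) x :
  bounded_fun f -> `|f x| <= sup_norm f.
Proof.
move=> [M [_ /(_ (M + 1)) fM]]; apply: ub_le_sup; last by exists x.
by exists (M + 1) => _ [y _ <-]; apply: fM => //; rewrite ltrDl.
Qed.

Section Eigenfunction.
Context {R : realType} {V : choiceType} {e : rel V} {D : nat}.
Hypothesis degD : forall x, (neighbors e x #<= `I_D)%card.
Hypothesis D_gt0 : (0 < D)%N.
Context {lambda : R} {f : V -> R}.
Hypothesis f_bounded : bounded_fun f.
Hypothesis f_neq0 : f <> cst 0.
Hypothesis f_eigen : forall x, - laplacian e f x = lambda * f x.

Local Notation W := (lazy_walk e D).
Local Notation mu := (1 - lambda / D%:R).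

Let D_gt0' : 0 < D%:R :> R. Proof. by rewrite ltr0n. Qed.

Lemma lazy_walk_eigen x : W f x = mu * f x.
Proof.
have -> : W f x = f x + laplacian e f x / D%:R by [].
by have := f_eigen x; move=> /(canRL (@opprK _)) ->; ring.
Qed.

Lemma exists_eigenfun_neq0 : exists x, f x != 0.
Proof.
apply: contrapT => f0; case: f_neq0; apply/funext => x.
by apply/eqP; rewrite -[_ == _]negbK; apply/negP => fx; apply: f0; exists x.
Qed.

(** The walk does not increase the sup norm, whereas a negative [lambda] would make it multiply [f]
    by [mu > 1]. *)
Lemma eigenvalue_ge0 : 0 <= lambda.
Proof.
have mW := is_markov_lazy_walk (R := R) degD D_gt0; case: (mW) => _ leW constW.
have [x0 fx0] := exists_eigenfun_neq0.
have M_gt0 : 0 < sup_norm f.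
  by have := sup_norm_ge f x0 f_bounded; apply: lt_le_trans; rewrite normr_gt0.
rewrite leNgt; apply/negP => l0.
have mu1 : 1 < mu by rewrite ltrDl oppr_gt0 pmulr_llt0 ?invr_gt0.
have : sup_norm f <= sup_norm f / mu.
  apply: ge_sup; first by exists `|f x0|; exists x0.
  move=> _ [x _ <-]; rewrite ler_pdivlMr; last by lra.
  rewrite mulrC -[X in X * _](@gtr0_norm _ mu); last by lra.
  rewrite -normrM -lazy_walk_eigen ler_norml; apply/andP; split.
    rewrite -[leLHS](constW _ x); apply: leW => z.
    by have := sup_norm_ge f z f_bounded; rewrite ler_norml => /andP[].
  rewrite -[leRHS](constW _ x); apply: leW => z.
  by have := sup_norm_ge f z f_bounded; rewrite ler_norml => /andP[].
rewrite ler_pdivlMr; last by lra.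
by rewrite -[leRHS]mulr1 ler_pM2l// leNgt mu1.
Qed.

(* A graph of maximal degree one is a disjoint union of edges and vertices. *)
Lemma eigenvalue_deg1 : symmetric e -> D = 1%N -> lambda = 0 \/ lambda = 2.
Proof.
move=> e_sym D1.
have lap1 x y : e x y -> laplacian e f x = f y - f x.
  move=> exy; rewrite (laplacianE degD).
  have := mem_nbr degD x y; have := size_nbr degD x; rewrite D1 exy.
  case: (finmap.enum_fset _) => [//|z [|//]] _ /=.
  by rewrite inE => /eqP ->; rewrite big_seq1 mul1r.
have [x fx] := exists_eigenfun_neq0.
have := f_eigen x; have [[y exy]|Nx] := pselect (exists y, e x y); last first.
  rewrite (laplacianE degD).
  have := mem_nbr degD x; case: (finmap.enum_fset _) => [_|z s /(_ z)].
    rewrite big_nil mul0r subr0 oppr0 => /esym/eqP; rewrite mulf_eq0 (negbTE fx).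
    by rewrite orbF => /eqP; left.
  by rewrite inE eqxx => /esym exz; case: Nx; exists z.
have := f_eigen y; rewrite (lap1 x y)// (lap1 y x) 1?e_sym// => Ey Ex.
have /eqP : lambda * (f x + f y) = 0 by lra.
rewrite mulf_eq0 => /orP[/eqP|/eqP fxy]; first by left.
right; apply: (mulIf fx); have -> : 2 * f x = - (f y - f x) by lra.
by rewrite Ex.
Qed.

(** * The gradient estimate for small eigenvalues *)

Section GradientEstimate.
Context {r : nat}.
Hypothesis r_gt0 : (0 < r)%N.
Hypothesis K0 : forall x y : V, (graph_dist R e x y <= r%:R%:E)%E ->
  (0 <= gradient_ollivier R e r x y)%E.
Hypothesis small : r%:R * D%:R ^+ (r - 1) * lambda < 1.
(** Together with [small], this ensures [a <= 1]: either [a = 0], or [2 / D <= 1] and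
    [r * lambda < 1]. *)
Hypothesis D2 : lambda = 0 \/ (1 < D)%N.

Local Notation g := (grad e r f).
Local Notation a := (2 * r%:R * lambda / D%:R).
Local Notation A := (iter r W).

Let l0 : 0 <= lambda := eigenvalue_ge0.

Let D1 : 1 <= D%:R :> R. Proof. by rewrite ler1n. Qed.

Let rl_lt1 : r%:R * lambda < 1.
Proof.
apply: le_lt_trans small; rewrite mulrAC ler_peMr//.
  by rewrite mulr_ge0.
by rewrite exprn_ege1.
Qed.

Let l_lt1 : lambda < 1.
Proof. by apply: le_lt_trans rl_lt1; rewrite ler_peMl// ler1n. Qed.

Let mu_itv : 0 <= mu <= 1.
Proof.
have : 0 <= lambda / D%:R by rewrite mulr_ge0 ?invr_ge0.
have : lambda / D%:R <= 1 by rewrite ler_pdivrMr//; move: l_lt1 D1; lra.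
by lra.
Qed.

Let a_ge0 : 0 <= a. Proof. by rewrite !mulr_ge0// invr_ge0. Qed.

Let a_le1 : a <= 1.
Proof.
case: D2 => [->|D_gt1]; first by rewrite mulr0 mul0r.
rewrite ler_pdivrMr// mul1r -mulrA.
have : 2 <= D%:R :> R by rewrite (ler_nat R 2).
by move: rl_lt1; lra.
Qed.

Let nu_le : 1 - a <= 2 * mu ^+ r - 1.
Proof.
have : 1 - r%:R * (lambda / D%:R) <= mu ^+ r.
  by apply: ge1_add_natmul_exprn; move: mu_itv; lra.
by lra.
Qed.

Let mu2_ge : (1 < r)%N -> D%:R^-1 <= mu ^+ 2.
Proof.
move=> r_gt1; case: D2 => [->|D_gt1].
  by rewrite mul0r subr0 expr1n invf_le1.
have D2' : 2 <= D%:R :> R by rewrite (ler_nat R 2).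
have r2 : 2 <= r%:R :> R by rewrite (ler_nat R 2).
have DE : D%:R <= D%:R ^+ (r - 1) :> R.
  by rewrite -[leLHS]expr1 ler_weXn2l// subn_gt0.
have l4 : 4 * lambda <= 1.
  apply: le_trans (ltW small); rewrite ler_wpM2r//.
  have -> : 4 = 2 * 2 :> R by lra.
  by rewrite ler_pM//; lra.
have Dinv : D%:R^-1 <= 2^-1 :> R by rewrite lef_pV2 ?posrE.
have : lambda * D%:R^-1 <= 4^-1 * 2^-1.
  by rewrite ler_pM ?invr_ge0//; move: l4; lra.
set b := lambda / _ => b8.
have : 0 <= (1 / 8 - b) * ((1 - b) + 7 / 8) by rewrite mulr_ge0//; lra.
by lra.
Qed.

Let g_ge0 := grad_ge0 degD r f.
Let mW := is_markov_lazy_walk (R := R) degD D_gt0.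
Let mA := is_markov_iter mW r.

Lemma lazy_walk_sqr_ge x :
  (1 - a) * f x ^+ 2 + D%:R^-1 ^+ r * g x ^+ 2 <= A (fun z => f z ^+ 2) x.
Proof.
have q0 : 0 <= D%:R^-1 :> R by rewrite invr_ge0.
have [y [/graph_dist_leP[p [xp py pr]] gE]] := grad_attained degD r f x.
apply: (@le_trans _ _ ((2 * mu ^+ r - 1) * f x ^+ 2 + D%:R^-1 ^+ r * g x ^+ 2)).
  by rewrite lerD2r ler_wpM2r ?sqr_ge0.
(* An empty path means [g x = 0], so the gradient term vanishes. A nonempty path shorter than [r]
   forces [1 < r], as [mu2_ge] requires. *)
have [p0|p_gt0] := posnP (size p).
  have -> : g x = 0.
    by rewrite -gE -py (size0nil p0) /= subrr normr0.
  rewrite expr0n; apply: (@markov_iter_eigen_sqr_ge _ _ _ _ _ _ _ r) => //.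
  - exact: lazy_walk_eigen.
  - by rewrite mulr0; apply: (markov_ge0 mA) => z; exact: sqr_ge0.
  - by left.
apply: (@markov_iter_eigen_sqr_ge _ _ _ _ _ _ _ (size p)) => //.
- exact: sqr_ge0.
- exact: lazy_walk_eigen.
- rewrite -gE -py real_normK ?num_real//.
  by apply: (iter_lazy_walk_ge degD D_gt0 _ x p) => // z; exact: sqr_ge0.
- have [pr'|pr'] := eqVneq (size p) r; [by left|right].
  by apply: mu2_ge; apply: leq_ltn_trans p_gt0 _; rewrite ltn_neqAle pr'.
Qed.

Lemma lazy_walk_grad_ge x : mu * g x <= W g x.
Proof.
have := laplacian_grad_ge degD r lambda f x (K0 x) f_eigen.
rewrite /lazy_walk mulrBl mul1r lerD2l -(ler_pM2r (x := D%:R^-1)) ?invr_gt0//.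
by lra.
Qed.

Lemma lazy_walk_grad_sqr_ge x : (1 - a) * g x ^+ 2 <= A (fun z => g z ^+ 2) x.
Proof.
have /andP[m0 m1] := mu_itv.
(* Uses [t ^+ 2 >= 2 * t - 1] at [t = mu ^+ r], so that [g ^+ 2] gets the same factor [1 - a] as
   [f ^+ 2]. *)
apply: (@le_trans _ _ ((mu ^+ r) ^+ 2 * g x ^+ 2)).
  rewrite ler_wpM2r ?sqr_ge0//; apply: (le_trans nu_le).
  by have := sqr_ge0 (mu ^+ r - 1); lra.
apply: (markov_jensen_le mA) => //; first exact: exprn_ge0.
by apply: (markov_iter_ge mW) => // z; exact: lazy_walk_grad_ge.
Qed.

Lemma grad_sqr_le_small x :
  g x ^+ 2 <= 2 * expR 1 * r%:R * D%:R ^+ (r - 1) * lambda * sup_norm f ^+ 2.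
Proof.
have d0 : 0 <= D%:R^-1 ^+ r :> R by rewrite exprn_ge0// invr_ge0.
have nu0 : 0 <= 1 - a by move: a_le1; lra.
have : D%:R^-1 ^+ r * g x ^+ 2 <= expR 1 * a * sup_norm f ^+ 2.
  apply: le_expR_of_natmul_exprn => //; first exact: sqr_ge0.
  move=> n.
  have := markov_iter_source_ge mA _ _ (fun z => f z ^+ 2) (fun z => g z ^+ 2)
    n x d0 nu0 lazy_walk_sqr_ge lazy_walk_grad_sqr_ge.
  have [_ leA constA] := is_markov_iter mA n.+1.
  have : iter n.+1 A (fun z => f z ^+ 2) x <= sup_norm f ^+ 2.
    rewrite -[leRHS](constA _ x); apply: leA => z.
    rewrite -real_normK ?num_real// lerXn2r ?nnegrE//.
      by apply: le_trans (normr_ge0 (f x)) _; exact: sup_norm_ge.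
    exact: sup_norm_ge.
  have : 0 <= (1 - a) ^+ n.+1 * f x ^+ 2.
    by apply: mulr_ge0; [exact: exprn_ge0 | exact: sqr_ge0].
  move=> h1 h2 h3.
  have -> : n.+1%:R * (1 - a) ^+ n * (D%:R^-1 ^+ r * g x ^+ 2)
    = n.+1%:R * D%:R^-1 ^+ r * (1 - a) ^+ n * g x ^+ 2 by ring.
  by lra.
(* Clearing [D^-r] costs [D ^+ r]; the denominator of [a] absorbs one factor, leaving the exponent
   [r - 1]. *)
rewrite exprVn mulrC ler_pdivrMr ?exprn_gt0// => /le_trans; apply.
have -> : D%:R ^+ r = D%:R * D%:R ^+ (r - 1) :> R.
  by rewrite -exprS subn1 prednK.
rewrite le_eqVlt; apply/orP; left; apply/eqP; field.
by rewrite gt_eqF.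
Qed.

End GradientEstimate.

(** * Large eigenvalues and the combination of both ranges *)

Lemma grad_sqr_le_large r x :
  4 <= 2 * expR 1 * r%:R * D%:R ^+ (r - 1) * lambda ->
  grad e r f x ^+ 2
    <= 2 * expR 1 * r%:R * D%:R ^+ (r - 1) * lambda * sup_norm f ^+ 2.
Proof.
move=> B4; apply: le_trans (ler_wpM2r (sqr_ge0 _) B4).
have -> : 4 * sup_norm f ^+ 2 = (2 * sup_norm f) ^+ 2 by ring.
have [y [_ gE]] := grad_attained degD r f x.
have := sup_norm_ge f x f_bounded; have := sup_norm_ge f y f_bounded => fy fx.
have := ler_normB (f y) (f x); have := normr_ge0 (f x) => fx0 fyx.
rewrite lerXn2r ?nnegrE ?(grad_ge0 degD)//; first lra.
by rewrite -gE; lra.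
Qed.

Lemma grad_sqr_le r x : symmetric e -> (0 < r)%N ->
  (forall x y : V, (graph_dist R e x y <= r%:R%:E)%E ->
     (0 <= gradient_ollivier R e r x y)%E) ->
  grad e r f x ^+ 2
    <= 2 * expR 1 * r%:R * D%:R ^+ (r - 1) * lambda * sup_norm f ^+ 2.
Proof.
move=> e_sym r_gt0 K0.
have [B4|B4] := leP 4 (2 * expR 1 * r%:R * D%:R ^+ (r - 1) * lambda).
  exact: grad_sqr_le_large.
(* Since [expR 1 >= 2], the prefactor [2 * expR 1] is at least 4, the threshold separating the two
   ranges. *)
have small : r%:R * D%:R ^+ (r - 1) * lambda < 1.
  rewrite -(ltr_pM2l (x := 4)) ?mulr1; last by [].
  apply: le_lt_trans B4.
  have -> : 2 * expR 1 * r%:R * D%:R ^+ (r - 1) * lambda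
    = 2 * expR 1 * (r%:R * D%:R ^+ (r - 1) * lambda) by ring.
  apply: ler_wpM2r.
    by rewrite !mulr_ge0 ?exprn_ge0//; exact: eigenvalue_ge0.
  by have := @expR_ge1Dx R 1; lra.
apply: grad_sqr_le_small => //.
have [D_gt1|D_le1] := ltnP 1 D; [by right|left].
have D1 : D = 1%N by apply/eqP; rewrite eqn_leq D_le1.
(* The eigenvalue 2 contradicts [small], which reads [r * 2 < 1] when [D = 1]. *)
have [//|l2] := eigenvalue_deg1 e_sym D1.
move: small; rewrite l2 D1 expr1n mulr1.
have : 1 <= r%:R :> R by rewrite ler1n.
by lra.
Qed.

End Eigenfunction.

Theorem mainTheorem8 (R : realType) (V : choiceType) (e : rel V)
    (e_sym : symmetric e) (e_irr : irreflexive e)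
    (Degmax : nat) (hDeg : max_degree e Degmax)
    (r : nat) (hr : (1 <= r)%N)
    (hK : forall x y : V, (graph_dist R e x y <= r%:R%:E)%E ->
            (0 <= gradient_ollivier R e r x y)%E)
    (lambda : R) (f : V -> R) (f_bounded : bounded_fun f)
    (f_neq0 : f <> cst 0)
    (f_eigen : forall x : V, - laplacian e f x = lambda * f x) :
  forall x : V,
    grad e r f x ^+ 2
      <= 2 * expR 1 * r%:R * Degmax%:R ^+ (r - 1) * lambda * sup_norm f ^+ 2.
Proof.
move=> x; have [degD _] := hDeg.
have [D0|D_gt0] := posnP Degmax; last exact: (grad_sqr_le degD).
(* Without edges the walk cannot be normalized by the degree, so the bound is applied with [D = 1].
   As [lambda = 0], both right-hand sides vanish, whatever the value of [0 ^+ (r - 1)]. *)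
have deg1 z : (neighbors e z #<= `I_1)%card.
  by apply: card_le_trans (degD z) _; rewrite D0 II0; exact: card_ge0.
have l0 : lambda = 0.
  have [z fz] := exists_eigenfun_neq0 f_neq0.
  have := f_eigen z; rewrite (laplacianE degD).
  have := size_nbr degD z; rewrite D0 leqn0 => /nilP ->.
  rewrite big_nil mul0r subr0 oppr0 => /esym/eqP.
  by rewrite mulf_eq0 (negbTE fz) orbF => /eqP.
have := grad_sqr_le deg1 isT f_bounded f_neq0 f_eigen r x e_sym hr hK.
by rewrite l0 !(mulr0, mul0r).
Qed.
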